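(* Let $\mathbf{H}\in\mathbb{H}^4$. The following are equivalent: (1) $\mathbf{Cov}_2(\mathbf{H})$ is transversely isotropic; (2) $\mathbf{H}$ is tetragonal, trigonal or transversely isotropic; (3) the pair $(\mathbf{d}_2,\mathbf{c}_3)$ is transversely isotropic.
   Context: $\mathbb{H}^4$ is the space of totally symmetric traceless fourth-order tensors on $\mathbb{R}^3$, with $SO(3)$-action $(g\star\mathbf{T})(x_1,\dots,x_n)=\mathbf{T}(g^{-1}x_1,\dots,g^{-1}x_n)$. $\mathbf{Cov}_2(\mathbf{H})\subset\mathrm{Sym}^2(\mathbb{R}^3)$ is the set of values at $\mathbf{H}$ of all $SO(3)$-equivariant polynomial maps $\mathbb{H}^4\to\mathrm{Sym}^2(\mathbb{R}^3)$. $(\mathbf{H}:\mathbf{H})_{ijkl}=H_{ijmn}H_{mnkl}$, $(\mathbf{H}:\mathbf{a})_{ij}=H_{ijkl}a_{kl}$, $(\operatorname{tr}_{13}\mathbf{A})_{ij}=A_{kikj}$, $\mathbf{d}_2=\operatorname{tr}_{13}(\mathbf{H}:\mathbf{H})$, $\mathbf{c}_3=\mathbf{H}:\mathbf{d}_2$. Symmetry group of a tensor: $\{g\in SO(3):g\star\mathbf{T}=\mathbf{T}\}$; of a family or subspace: intersection of members' groups; symmetry class: its conjugacy class. Transversely isotropic $=[O(2)]$, tetragonal $=[\mathbb{D}_4]$, trigonal $=[\mathbb{D}_3]$, where $O(2)$ is generated by rotations about the $z$-axis and the rotation by $\pi$ about the $x$-axis, and $\mathbb{D}_n$ is generated by the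 rotation by $2\pi/n$ about the $z$-axis and the rotation by $\pi$ about the $x$-axis. *)

(* Defs.v *)
From HB Require Import structures.
From mathcomp Require Import all_boot all_order all_algebra all_fingroup.
From mathcomp Require Import reals.
Set Implicit Arguments. Unset Strict Implicit. Unset Printing Implicit Defensive.
Import Order.TTheory GRing.Theory Num.Theory.
Local Open Scope ring_scope.

Section Defs.
Variable R : realType.

(* Fourth-order tensors on R^3, components T (i,j,k,l) = T_{ijkl}
   (w.r.t. the standard orthonormal basis). *)
Definition tensor4 := {ffun 'I_3 * 'I_3 * 'I_3 * 'I_3 -> R}.
Definition tensor2 := 'M[R]_3.

Definition idx4 (x : 'I_4 -> 'I_3) : 'I_3 * 'I_3 * 'I_3 * 'I_3 :=
  (x 0%R, x 1%R, x 2%R, x 3%R).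

Definition totally_symmetric (T : tensor4) : Prop :=
  forall (s : 'S_4) (x : 'I_4 -> 'I_3), T (idx4 (x \o s)) = T (idx4 x).

Definition traceless (T : tensor4) : Prop :=
  forall i j : 'I_3, \sum_(k < 3) T (k, k, i, j) = 0.

Definition inH4 (T : tensor4) : Prop := totally_symmetric T /\ traceless T.

Definition inSym2 (A : tensor2) : Prop := A^T = A.

Definition SO3 (g : 'M[R]_3) : Prop := g^T *m g = 1%:M /\ \det g = 1.

(* (g * T)(x1,..,xn) = T(g^-1 x1, .., g^-1 xn), in components *)
Definition act4 (g : 'M[R]_3) (T : tensor4) : tensor4 :=
  [ffun x => let: (i, j, k, l) := x in
     \sum_(a < 3) \sum_(b < 3) \sum_(c < 3) \sum_(d < 3)
       invmx g a i * invmx g b j * invmx g c k * invmx g d l * T (a, b, c, d)].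

Definition act2 (g : 'M[R]_3) (A : tensor2) : tensor2 :=
  \matrix_(i, j) \sum_(a < 3) \sum_(b < 3) invmx g a i * invmx g b j * A a b.

Inductive polyfun : (tensor4 -> R) -> Prop :=
  | pf_const (c : R) : polyfun (fun _ => c)
  | pf_coord (x : 'I_3 * 'I_3 * 'I_3 * 'I_3) : polyfun (fun T => T x)
  | pf_add p q : polyfun p -> polyfun q -> polyfun (fun T => p T + q T)
  | pf_mul p q : polyfun p -> polyfun q -> polyfun (fun T => p T * q T).

Definition equiv_poly_map (f : tensor4 -> tensor2) : Prop :=
  (forall i j, polyfun (fun T => f T i j)) /\
  (forall T, inH4 T -> inSym2 (f T)) /\
  (forall g T, SO3 g -> inH4 T -> f (act4 g T) = act2 g (f T)).

Definition Cov2 (H : tensor4) (A : tensor2) : Prop :=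
  exists f, equiv_poly_map f /\ A = f H.

Definition subgroup (G : 'M[R]_3 -> Prop) : Prop :=
  (forall g, G g -> SO3 g) /\ G 1%:M /\
  (forall a b, G a -> G b -> G (a *m b)) /\ (forall a, G a -> G (invmx a)).

Definition generated (S : 'M[R]_3 -> Prop) (g : 'M[R]_3) : Prop :=
  forall G, subgroup G -> (forall x, S x -> G x) -> G g.

Definition rotz (c s : R) : 'M[R]_3 :=
  \matrix_(i < 3, j < 3)
    match nat_of_ord i, nat_of_ord j with
    | 0, 0 => c | 0, 1 => - s | 1, 0 => s | 1, 1 => c | 2, 2 => 1
    | _, _ => 0 end.

Definition rotx_pi : 'M[R]_3 :=
  \matrix_(i < 3, j < 3) if i == j then (if nat_of_ord i == 0%N then 1 else -1) else 0.

Definition O2 : 'M[R]_3 -> Prop :=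
  generated (fun g => (exists c s, c ^+ 2 + s ^+ 2 = 1 /\ g = rotz c s) \/ g = rotx_pi).

Definition D4 : 'M[R]_3 -> Prop :=
  generated (fun g => g = rotz 0 1 \/ g = rotx_pi).

(* D_3: generated by rotation by 2pi/3 about z (cos = -1/2, sin = sqrt 3 / 2) and rotx_pi *)
Definition D3 : 'M[R]_3 -> Prop :=
  generated (fun g => g = rotz (- (2%:R)^-1) (Num.sqrt 3%:R / 2%:R) \/ g = rotx_pi).

Definition sym4 (T : tensor4) (g : 'M[R]_3) : Prop := SO3 g /\ act4 g T = T.
Definition sym2 (A : tensor2) (g : 'M[R]_3) : Prop := SO3 g /\ act2 g A = A.
Definition sym_family (F : tensor2 -> Prop) (g : 'M[R]_3) : Prop :=
  SO3 g /\ forall A, F A -> act2 g A = A.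

Definition in_class (G K : 'M[R]_3 -> Prop) : Prop :=
  exists h, SO3 h /\ forall g, G g <-> K (invmx h *m g *m h).

Definition dcontr44 (A B : tensor4) : tensor4 :=
  [ffun x => let: (i, j, k, l) := x in
     \sum_(m < 3) \sum_(n < 3) A (i, j, m, n) * B (m, n, k, l)].
Definition tr13 (A : tensor4) : tensor2 := \matrix_(i, j) \sum_(k < 3) A (k, i, k, j).
Definition dcontr42 (A : tensor4) (a : tensor2) : tensor2 :=
  \matrix_(i, j) \sum_(k < 3) \sum_(l < 3) A (i, j, k, l) * a k l.
Definition d2 (H : tensor4) : tensor2 := tr13 (dcontr44 H H).
Definition c3 (H : tensor4) : tensor2 := dcontr42 H (d2 H).

End Defs.

(* Main.v *)
(* Everything rests on the axis of a transversely isotropic covariant.  If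
   [A = diag (a, a, b)] with [a != b] is a covariant of [H] and [H : A] is
   transversely isotropic with the same axis [z], then so is [H : (z (x) z)]
   (the trace part of [A] is killed), so [H] has only components of weight 0, 3
   and 4 under rotations about [z].  The weight 1 part of [d2] is the product
   of the weight 3 and weight 4 parts up to conjugation, so its vanishing kills
   one of the two, and a rotation about [z] brings [H] into a tetragonal or
   trigonal normal form, whose symmetry group is D4, D3 or O(2) as soon as it
   is contained in O(2).  In (3) one takes [A = d2], in (1) any non-isotropic
   covariant.  Conversely a tensor fixed by D4 or D3 is in normal form and its
   second-order covariants are all of the form [diag (a, a, b)]; if [d2] were
   isotropic, [H] would be cubic (or zero) and have a symmetry outside O(2). *)

Require Import Defs.
From HB Require Import structures.
From mathcomp Require Import all_boot all_order all_algebra.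
From mathcomp Require Import reals.
From mathcomp Require Import perm boolp ring lra.
Set Implicit Arguments. Unset Strict Implicit. Unset Printing Implicit Defensive.
Import Order.TTheory GRing.Theory Num.Theory.
Local Open Scope ring_scope.

(** * Rotations and their action on tensors *)

Definition o0 : 'I_3 := @Ordinal 3 0 isT.
Definition o1 : 'I_3 := @Ordinal 3 1 isT.
Definition o2 : 'I_3 := @Ordinal 3 2 isT.

Lemma ord3_ind (P : 'I_3 -> Prop) : P o0 -> P o1 -> P o2 -> forall i, P i.
Proof.
move=> P0 P1 P2 [[|[|[|//]]] lt_i3].
- by rewrite (_ : Ordinal _ = o0) //; apply: val_inj.
- by rewrite (_ : Ordinal _ = o1) //; apply: val_inj.
- by rewrite (_ : Ordinal _ = o2) //; apply: val_inj.
Qed.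

Lemma sum3 (V : nmodType) (F : 'I_3 -> V) :
  \sum_(i < 3) F i = F o0 + F o1 + F o2.
Proof.
rewrite !big_ord_recl big_ord0 addr0 addrA.
by congr (F _ + F _ + F _); apply: val_inj.
Qed.

Lemma ord4_ind (P : 'I_4 -> Prop) :
  P 0 -> P 1 -> P 2 -> P 3 -> forall i, P i.
Proof.
move=> P0 P1 P2 P3 [[|[|[|[|//]]]] lt_i4].
- by rewrite (_ : Ordinal _ = 0) //; apply: val_inj.
- by rewrite (_ : Ordinal _ = 1) //; apply: val_inj.
- by rewrite (_ : Ordinal _ = 2) //; apply: val_inj.
- by rewrite (_ : Ordinal _ = 3) //; apply: val_inj.
Qed.

Section TensorAction.
Variable R : realType.
Implicit Types (g h : 'M[R]_3) (A B : tensor2 R) (T H : tensor4 R).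

Lemma SO3_inv g : SO3 g -> invmx g = g^T.
Proof.
move=> [gTg _]; have [gu _] := mulmx1_unit gTg.
have [_ gu'] := mulmx1_unit gTg.
by rewrite -[RHS]mulmx1 -(mulmxV gu') mulmxA gTg mul1mx.
Qed.

Lemma SO3_mulmxT g : SO3 g -> g *m g^T = 1%:M.
Proof. by case=> gTg _; apply: mulmx1C. Qed.

Lemma SO3_1 : SO3 (1%:M : 'M[R]_3).
Proof. by split; rewrite ?trmx1 ?mulmx1 ?det1. Qed.

Lemma SO3_mul g h : SO3 g -> SO3 h -> SO3 (g *m h).
Proof.
move=> [gg dg] [hh dh]; split; last by rewrite det_mulmx dg dh mulr1.
by rewrite trmx_mul mulmxA -(mulmxA h^T) gg mulmx1.
Qed.

Lemma SO3_tr g : SO3 g -> SO3 g^T.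
Proof.
move=> gS; split; first by rewrite trmxK SO3_mulmxT.
by rewrite det_tr; case: gS.
Qed.

Lemma SO3_invmx g : SO3 g -> SO3 (invmx g).
Proof. by move=> gS; rewrite SO3_inv //; apply: SO3_tr. Qed.

Lemma SO3_mulmxV g : SO3 g -> g *m invmx g = 1%:M.
Proof. by move=> gS; rewrite SO3_inv // SO3_mulmxT. Qed.

Lemma SO3_mulVmx g : SO3 g -> invmx g *m g = 1%:M.
Proof. by move=> gS; rewrite SO3_inv //; case: gS. Qed.

(** A rotation is applied to one index at a time, so that every identity about tensor actions
    reduces to commuting, composing or cancelling single contractions. *)
Definition ap g (u : 'I_3 -> R) (i : 'I_3) : R := \sum_a g i a * u a.

Lemma eq_ap g u v i : u =1 v -> ap g u i = ap g v i.
Proof. by move=> uv; apply: eq_bigr => a _; rewrite uv. Qed.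

Lemma ap1 u i : ap 1%:M u i = u i.
Proof.
rewrite /ap (bigD1 i) //= mxE eqxx mul1r big1 ?addr0 // => a /negPf ai.
by rewrite mxE eq_sym ai mul0r.
Qed.

Lemma ap_mul g h u i : ap g (ap h u) i = ap (g *m h) u i.
Proof.
rewrite /ap; under eq_bigr do rewrite mulr_sumr.
rewrite exchange_big; apply: eq_bigr => b _.
by rewrite mxE mulr_suml; apply: eq_bigr => a _; rewrite mulrA.
Qed.

Lemma ap_sum g (F : 'I_3 -> 'I_3 -> R) i :
  \sum_k ap g (fun a => F a k) i = ap g (fun a => \sum_k F a k) i.
Proof.
by rewrite exchange_big; apply: eq_bigr => a _; rewrite mulr_sumr.
Qed.

Lemma ap_comm g h (F : 'I_3 -> 'I_3 -> R) i j :
  ap g (fun a => ap h (F a) j) i = ap h (fun b => ap g (F^~ b) i) j.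
Proof.
rewrite /ap; under eq_bigr do rewrite mulr_sumr.
rewrite exchange_big; apply: eq_bigr => b _.
by rewrite mulr_sumr; apply: eq_bigr => a _; rewrite mulrCA.
Qed.

Lemma ap_adjoint g u v : \sum_k ap g u k * v k = \sum_k u k * ap g^T v k.
Proof.
rewrite /ap; under eq_bigr do rewrite mulr_suml.
rewrite exchange_big; apply: eq_bigr => a _.
by rewrite mulr_sumr; apply: eq_bigr => k _; rewrite mxE mulrAC mulrA mulrC mulrA.
Qed.

Lemma ap_dot g u v : SO3 g ->
  \sum_k ap g u k * ap g v k = \sum_k u k * v k.
Proof.
move=> [gTg _]; rewrite ap_adjoint; apply: eq_bigr => k _.
by rewrite ap_mul gTg ap1.
Qed.

Lemma ap_prod g u v i j :
  ap g u i * ap g v j = ap g (fun a => ap g (fun b => u a * v b) j) i.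
Proof.
rewrite /ap mulr_suml; apply: eq_bigr => a _.
rewrite -mulrA; congr (_ * _); rewrite mulr_sumr.
by apply: eq_bigr => b _; rewrite mulrCA.
Qed.

Lemma ap2_scale g (F : 'I_3 -> 'I_3 -> R) (x : R) i j :
  ap g (fun a => ap g (F a) j) i * x =
  ap g (fun a => ap g (fun b => F a b * x) j) i.
Proof.
rewrite /ap mulr_suml; apply: eq_bigr => a _; rewrite -mulrA; congr (_ * _).
by rewrite mulr_suml; apply: eq_bigr => b _; rewrite mulrA.
Qed.

Lemma ap2_sum g (F : 'I_3 -> 'I_3 -> 'I_3 -> R) i j :
  \sum_k ap g (fun a => ap g (fun b => F k a b) j) i =
  ap g (fun a => ap g (fun b => \sum_k F k a b) j) i.
Proof.
by rewrite ap_sum; apply: eq_ap => a; rewrite ap_sum.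
Qed.

Lemma act2E g A i j : SO3 g ->
  act2 g A i j = ap g (fun a => ap g (fun b => A a b) j) i.
Proof.
move=> gS; rewrite mxE; apply: eq_bigr => a _; rewrite mulr_sumr.
by apply: eq_bigr => b _; rewrite SO3_inv // !mxE mulrA.
Qed.

Lemma act4E g T i j k l : SO3 g ->
  act4 g T (i, j, k, l) =
  ap g (fun a => ap g (fun b => ap g (fun c => ap g (fun d =>
    T (a, b, c, d)) l) k) j) i.
Proof.
move=> gS; rewrite ffunE; apply: eq_bigr => a _; rewrite mulr_sumr.
apply: eq_bigr => b _; rewrite !mulr_sumr; apply: eq_bigr => c _.
rewrite !mulr_sumr; apply: eq_bigr => d _.
by rewrite SO3_inv // !mxE !mulrA.
Qed.

Lemma tensor4P T H : (forall i j k l, T (i, j, k, l) = H (i, j, k, l)) -> T = H.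
Proof. by move=> TH; apply/ffunP=> -[[[i j] k] l]. Qed.

Lemma act2_mx g A : SO3 g -> act2 g A = g *m A *m g^T.
Proof.
move=> gS; apply/matrixP=> i j; rewrite act2E // mxE.
under eq_bigr do rewrite mxE mulr_suml.
rewrite exchange_big; apply: eq_bigr => a _; rewrite mulr_sumr.
by apply: eq_bigr => b _; rewrite mxE -mulrA [A a b * _]mulrC.
Qed.

Lemma act2_1 A : act2 1%:M A = A.
Proof. by rewrite act2_mx ?trmx1 ?mulmx1 ?mul1mx //; apply: SO3_1. Qed.

Lemma act2M g h A : SO3 g -> SO3 h -> act2 (g *m h) A = act2 g (act2 h A).
Proof.
move=> gS hS; rewrite !act2_mx //; last exact: SO3_mul.
by rewrite trmx_mul !mulmxA.
Qed.

Lemma act4_1 T : act4 1%:M T = T.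
Proof.
apply: tensor4P => i j k l; rewrite act4E ?ap1 //; exact: SO3_1.
Qed.

Lemma ap_comm2 g h (F : 'I_3 -> 'I_3 -> 'I_3 -> R) i j k :
  ap g (fun a => ap g (fun b => ap h (F a b) k) j) i =
  ap h (fun c => ap g (fun a => ap g (fun b => F a b c) j) i) k.
Proof. by under eq_ap do rewrite ap_comm; rewrite ap_comm. Qed.

Lemma ap_comm3 g h (F : 'I_3 -> 'I_3 -> 'I_3 -> 'I_3 -> R) i j k l :
  ap g (fun a => ap g (fun b => ap g (fun c => ap h (F a b c) l) k) j) i =
  ap h (fun d => ap g (fun a => ap g (fun b => ap g (fun c => F a b c d) k) j) i) l.
Proof. by under eq_ap do rewrite ap_comm2; rewrite ap_comm. Qed.

Lemma act4M g h T : SO3 g -> SO3 h -> act4 (g *m h) T = act4 g (act4 h T).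
Proof.
move=> gS hS; have ghS := SO3_mul gS hS.
apply: tensor4P => i j k l; rewrite [LHS]act4E // [RHS]act4E //; symmetry.
under eq_ap do (under eq_ap do (under eq_ap do (under eq_ap do rewrite act4E //))).
under eq_ap do rewrite ap_comm3.
rewrite ap_mul; apply: eq_ap => a.
under eq_ap do rewrite ap_comm2.
rewrite ap_mul; apply: eq_ap => b.
under eq_ap do rewrite ap_comm.
rewrite ap_mul; apply: eq_ap => c.
by rewrite ap_mul.
Qed.

Lemma ap_trace g (F : 'I_3 -> 'I_3 -> R) : SO3 g ->
  \sum_k ap g (fun a => ap g (F a) k) k = \sum_a F a a.
Proof.
move=> [gTg _]; rewrite exchange_big; apply: eq_bigr => a _.
rewrite -[RHS](ap1 (F a)) -gTg -ap_mul.
by apply: eq_bigr => k _; rewrite mxE.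
Qed.

Lemma ap0 g i : ap g (fun=> 0) i = 0.
Proof. by rewrite /ap big1 // => a _; rewrite mulr0. Qed.

Lemma inH4P T : inH4 T <->
  [/\ forall i j k l, T (i, j, k, l) = T (j, i, k, l),
      forall i j k l, T (i, j, k, l) = T (i, k, j, l),
      forall i j k l, T (i, j, k, l) = T (i, j, l, k) & traceless T].
Proof.
split=> [[sT trT]|[s1 s2 s3 trT]]; last first.
{ split=> // s x; rewrite /idx4 /=.
  (* Injectivity on the six pairs discards all but 24 of the 256 conceivable value tuples of [s]. *)
  have inj_s p q : (s p != s q) = (p != q) by rewrite (inj_eq (@perm_inj _ s)).
  move: (inj_s 0 1) (inj_s 0 2) (inj_s 0 3) (inj_s 1 2) (inj_s 1 3) (inj_s 2 3).
  move: (s 0) (s 1) (s 2) (s 3).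
  do 4! elim/ord4_ind; move=> // _ _ _ _ _ _.
  all: move: (x 0) (x 1) (x 2) (x 3) => a b c d.
  (* One reduced word in the three adjacent transpositions for each of the 23 nontrivial
     permutations; the longest has length 6. *)
  all: first [ by rewrite s3 | by rewrite s2 | by rewrite s1 | by rewrite s3
      s2 | by rewrite s2 s3 | by rewrite s2 s1 | by rewrite s1 s3 | by
      rewrite s1 s2 | by rewrite s3 s2 s1 | by rewrite s2 s3 s2 | by rewrite
      s2 s1 s3 | by rewrite s1 s3 s2 | by rewrite s1 s2 s3 | by rewrite s1
      s2 s1 | by rewrite s2 s3 s2 s1 | by rewrite s2 s1 s3 s2 | by rewrite
      s1 s3 s2 s1 | by rewrite s1 s2 s3 s2 | by rewrite s1 s2 s1 s3 | by
      rewrite s2 s1 s3 s2 s1 | by rewrite s1 s2 s3 s2 s1 | by rewrite s1 s2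
      s1 s3 s2 | by rewrite s1 s2 s1 s3 s2 s1 ]. }
have swap (p q : 'I_4) i j k l :
    let x := fun n : 'I_4 => nth o0 [:: i; j; k; l] n in
    T (idx4 x) = T (idx4 (x \o tperm p q)) by move=> x; rewrite sT.
split=> // i j k l.
- have := swap 0 1 i j k l; rewrite /idx4 /= tpermL tpermR.
  by rewrite !tpermD.
- have := swap 1 2 i j k l; rewrite /idx4 /= tpermL tpermR.
  by rewrite !tpermD.
- have := swap 2 3 i j k l; rewrite /idx4 /= tpermL tpermR.
  by rewrite !tpermD.
Qed.

Lemma act4_inH4 g T : SO3 g -> inH4 T -> inH4 (act4 g T).
Proof.
move=> gS /inH4P[s1 s2 s3 trT]; apply/inH4P; split.
- move=> i j k l; rewrite !act4E // ap_comm.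
  by do 4! apply: eq_ap => ?.
- move=> i j k l; rewrite !act4E //; apply: eq_ap => a; rewrite ap_comm.
  by do 3! apply: eq_ap => ?.
- move=> i j k l; rewrite !act4E //; apply: eq_ap => a; apply: eq_ap => b.
  by rewrite ap_comm; do 2! apply: eq_ap => ?.
move=> i j; under eq_bigr do rewrite act4E //.
rewrite ap_trace //.
rewrite ap2_sum; under eq_ap do (under eq_ap do rewrite trT; rewrite ap0).
exact: ap0.
Qed.

Lemma ap3_dot g (F G : 'I_3 -> 'I_3 -> 'I_3 -> R) : SO3 g ->
  \sum_k \sum_m \sum_n
     ap g (fun a => ap g (fun b => ap g (F a b) n) m) k *
     ap g (fun a => ap g (fun b => ap g (G a b) n) m) k =
  \sum_k \sum_m \sum_n F k m n * G k m n.
Proof.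
move=> gS.
transitivity (\sum_n \sum_m \sum_k
     ap g (fun a => ap g (fun b => ap g (F a b) n) m) k *
     ap g (fun a => ap g (fun b => ap g (G a b) n) m) k).
  rewrite exchange_big /= [RHS]exchange_big /=; apply: eq_bigr => m _.
  by rewrite exchange_big.
under eq_bigr do (under eq_bigr do rewrite ap_dot //).
under eq_bigr do (rewrite exchange_big; under eq_bigr do rewrite ap_dot //).
rewrite exchange_big; apply: eq_bigr => k _.
by rewrite exchange_big; apply: eq_bigr => m _; rewrite ap_dot.
Qed.

(** * Equivariance of [d2] and [c3] *)

Lemma d2E T i j : d2 T i j =
  \sum_k \sum_m \sum_n T (k, i, m, n) * T (m, n, k, j).
Proof. by rewrite mxE; apply: eq_bigr => k _; rewrite ffunE. Qed.

Lemma d2_act g T : SO3 g -> d2 (act4 g T) = act2 g (d2 T).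
Proof.
move=> gS; apply/matrixP=> i j; rewrite act2E // d2E.
(* [F] and [G] are the two factors with only their free index rotated; the rotations on the three
   contracted pairs cancel by orthogonality. *)
pose F k m n := ap g (fun b => T (k, b, m, n)) i.
pose G k m n := ap g (fun d => T (m, n, k, d)) j.
transitivity (\sum_k \sum_m \sum_n
     ap g (fun a => ap g (fun b => ap g (F a b) n) m) k *
     ap g (fun a => ap g (fun b => ap g (G a b) n) m) k).
  apply: eq_bigr => k _; apply: eq_bigr => m _; apply: eq_bigr => n _.
  rewrite !act4E //; congr (_ * _).
    by apply: eq_ap => a; rewrite -ap_comm2.
  by rewrite ap_comm2.
rewrite ap3_dot //.
under eq_bigr do (under eq_bigr do (under eq_bigr do rewrite ap_prod)).
under eq_bigr do (under eq_bigr do rewrite ap2_sum; rewrite ap2_sum).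
rewrite ap2_sum; apply: eq_ap => a; apply: eq_ap => b.
by rewrite d2E.
Qed.

Lemma dcontr42_act g T A : SO3 g ->
  dcontr42 (act4 g T) (act2 g A) = act2 g (dcontr42 T A).
Proof.
move=> gS; apply/matrixP=> i j; rewrite act2E // mxE.
pose F k l := ap g (fun a => ap g (fun b => T (a, b, k, l)) j) i.
transitivity (\sum_k \sum_l ap g (fun c => ap g (F c) l) k *
                           ap g (fun c => ap g (A c) l) k).
  apply: eq_bigr => k _; apply: eq_bigr => l _.
  rewrite act4E // act2E //; congr (_ * _).
  rewrite ap_comm2; apply: eq_ap => c; rewrite ap_comm2.
  by [].
rewrite exchange_big; under eq_bigr do rewrite ap_dot //.
rewrite exchange_big; under eq_bigr do rewrite ap_dot //.
under eq_bigr do under eq_bigr do rewrite ap2_scale.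
under eq_bigr do rewrite ap2_sum.
rewrite ap2_sum; apply: eq_ap => a; apply: eq_ap => b.
by rewrite mxE.
Qed.

Lemma c3_act g T : SO3 g -> c3 (act4 g T) = act2 g (c3 T).
Proof. by move=> gS; rewrite /c3 d2_act // dcontr42_act. Qed.

Lemma inH4_pair_swap T i j k l : inH4 T -> T (i, j, k, l) = T (k, l, i, j).
Proof. by move=> /inH4P[s1 s2 s3 _]; rewrite s2 s1 s3 s2. Qed.

Lemma d2_sym T : inH4 T -> inSym2 (d2 T).
Proof.
move=> TH; apply/matrixP=> i j; rewrite mxE !d2E.
apply: eq_bigr => k _; apply: eq_bigr => m _; apply: eq_bigr => n _.
by rewrite mulrC !(inH4_pair_swap m n k).
Qed.

Lemma dcontr42_sym T A : inH4 T -> inSym2 (dcontr42 T A).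
Proof.
move=> /inH4P[s1 _ _ _]; apply/matrixP=> i j; rewrite !mxE.
by apply: eq_bigr => k _; apply: eq_bigr => l _; rewrite s1.
Qed.

(** * Covariants *)

Lemma polyfun_sum (F : 'I_3 -> tensor4 R -> R) :
  (forall i, polyfun (F i)) -> polyfun (fun T => \sum_i F i T).
Proof.
move=> pF; rewrite (_ : (fun _ => _) = fun T => F o0 T + F o1 T + F o2 T).
  by do 2?[apply: pf_add].
by apply/funext => T; rewrite sum3.
Qed.

Lemma equiv_poly_d2 : equiv_poly_map (@d2 R).
Proof.
split=> [i j|].
  rewrite (_ : (fun _ => _) = fun T => \sum_k \sum_m \sum_n
     T (k, i, m, n) * T (m, n, k, j)); last by apply/funext => T; rewrite d2E.
  do 3! apply: polyfun_sum => ?.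
  by apply: pf_mul; apply: pf_coord.
by split=> [T TH|g T gS _]; [exact: d2_sym|exact: d2_act].
Qed.

Lemma Cov2_d2 H : Cov2 H (d2 H).
Proof. by exists (@d2 R); split=> //; apply: equiv_poly_d2. Qed.

(** This closure property produces [c3] from [d2], and lets any non-isotropic covariant play the
    part of [d2] in finding the axis. *)
Lemma equiv_poly_dcontr f :
  equiv_poly_map f -> equiv_poly_map (fun T => dcontr42 T (f T)).
Proof.
move=> [fP [fS fE]]; split=> [i j|].
  rewrite (_ : (fun _ => _) = fun T => \sum_k \sum_l
     T (i, j, k, l) * f T k l); last by apply/funext => T; rewrite mxE.
  do 2! apply: polyfun_sum => ?.
  by apply: pf_mul => //; apply: pf_coord.
split=> [T TH|g T gS TH]; first exact: dcontr42_sym.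
by rewrite fE // dcontr42_act.
Qed.

Lemma Cov2_dcontr H A : Cov2 H A -> Cov2 H (dcontr42 H A).
Proof.
move=> [f [fE ->]]; exists (fun T => dcontr42 T (f T)); split=> //.
exact: equiv_poly_dcontr.
Qed.

Lemma Cov2_c3 H : Cov2 H (c3 H).
Proof. exact/Cov2_dcontr/Cov2_d2. Qed.

Lemma Cov2_sym H A : inH4 H -> Cov2 H A -> inSym2 A.
Proof. by move=> HH [f [[_ [fS _]] ->]]; apply: fS. Qed.

(** Equivariance gives [f H = f (g H) = g (f H)]: a covariant can only gain symmetries. *)
Lemma Cov2_fix H A g : inH4 H -> Cov2 H A -> sym4 H g -> act2 g A = A.
Proof. by move=> HH [f [[_ [_ fE]] ->]] [gS gH]; rewrite -fE // gH. Qed.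

Lemma Cov2_act H A h : inH4 H -> SO3 h -> Cov2 H A -> Cov2 (act4 h H) (act2 h A).
Proof. by move=> HH hS [f [fE ->]]; exists f; split=> //; rewrite fE.2.2. Qed.

(** * Conjugation of symmetry groups *)

Lemma act4K h T : SO3 h -> act4 (invmx h) (act4 h T) = T.
Proof.
by move=> hS; rewrite -act4M ?SO3_mulVmx ?act4_1 //; apply: SO3_invmx.
Qed.

Lemma act4VK h T : SO3 h -> act4 h (act4 (invmx h) T) = T.
Proof.
by move=> hS; rewrite -act4M ?SO3_mulmxV ?act4_1 //; apply: SO3_invmx.
Qed.

Lemma act2K h A : SO3 h -> act2 (invmx h) (act2 h A) = A.
Proof.
by move=> hS; rewrite -act2M ?SO3_mulVmx ?act2_1 //; apply: SO3_invmx.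
Qed.

Lemma act2VK h A : SO3 h -> act2 h (act2 (invmx h) A) = A.
Proof.
by move=> hS; rewrite -act2M ?SO3_mulmxV ?act2_1 //; apply: SO3_invmx.
Qed.

Lemma SO3_conj h g : SO3 h -> SO3 (invmx h *m g *m h) <-> SO3 g.
Proof.
move=> hS; have hVS := SO3_invmx hS.
split=> gS; last by apply: SO3_mul => //; apply: SO3_mul.
have -> : g = h *m (invmx h *m g *m h) *m invmx h.
  by rewrite !mulmxA SO3_mulmxV // mul1mx -mulmxA SO3_mulmxV // mulmx1.
by apply: SO3_mul => //; apply: SO3_mul.
Qed.

Lemma act4_conj_fix h g T : SO3 h -> SO3 g ->
  act4 g (act4 h T) = act4 h T <-> act4 (invmx h *m g *m h) T = T.
Proof.
move=> hS gS; have hVS := SO3_invmx hS.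
rewrite act4M ?act4M //; last exact: SO3_mul.
by split=> [->|{2}<-]; rewrite ?act4K ?act4VK.
Qed.

Lemma act2_conj_fix h g A : SO3 h -> SO3 g ->
  act2 g (act2 h A) = act2 h A <-> act2 (invmx h *m g *m h) A = A.
Proof.
move=> hS gS; have hVS := SO3_invmx hS.
rewrite act2M ?act2M //; last exact: SO3_mul.
by split=> [->|{2}<-]; rewrite ?act2K ?act2VK.
Qed.

(** The feature shared by the groups of [H], of its covariants and of the pair, which allows any of
    them to be put in standard position by rotating [H]. *)
Definition conj_natural (S : tensor4 R -> 'M[R]_3 -> Prop) :=
  forall h T g, SO3 h -> inH4 T ->
    S (act4 h T) g <-> S T (invmx h *m g *m h).

Lemma sym4_natural : conj_natural (@sym4 R).
Proof.
move=> h T g hS _; split=> -[gS gT].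
  by split; [apply/SO3_conj|apply/act4_conj_fix].
have {}gS : SO3 g by apply/(SO3_conj g hS).
by split=> //; apply/act4_conj_fix.
Qed.

Definition sym_pair T g := sym2 (d2 T) g /\ sym2 (c3 T) g.

Lemma sym_pair_natural : conj_natural sym_pair.
Proof.
move=> h T g hS _; rewrite /sym_pair /sym2 d2_act // c3_act //.
split=> -[[gS d2T] [_ c3T]].
  by split; split; [apply/SO3_conj|apply/act2_conj_fix|
                    apply/SO3_conj|apply/act2_conj_fix].
have {}gS : SO3 g by apply/(SO3_conj g hS).
by split; split=> //; apply/act2_conj_fix.
Qed.

Lemma sym_Cov2_natural : conj_natural (fun T => sym_family (Cov2 T)).
Proof.
move=> h T g hS TH; split=> -[gS gA].
  split=> [|A TA]; first exact/SO3_conj.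
  by apply/act2_conj_fix => //; apply: gA; apply: Cov2_act.
have {}gS : SO3 g by apply/(SO3_conj g hS).
split=> // A TA; rewrite -(act2VK A hS); apply/act2_conj_fix => //.
apply: gA; rewrite -(act4K T hS); apply: Cov2_act => //.
  exact: act4_inH4.
exact: SO3_invmx.
Qed.

(** The conjugating rotation passes from the group to the tensor, inverted; afterwards the group is
    [K] itself and not a conjugate. *)
Lemma in_class_natural S H (K : 'M[R]_3 -> Prop) : conj_natural S -> inH4 H ->
  in_class (S H) K <->
  exists2 h, SO3 h & forall g, S (act4 h H) g <-> K g.
Proof.
move=> Snat HH; split=> -[h].
  move=> [hS SK]; exists (invmx h); first exact: SO3_invmx.
  move=> g; rewrite Snat ?invmxK //; last exact: SO3_invmx.
  rewrite SK !mulmxA SO3_mulVmx // mul1mx -mulmxA SO3_mulVmx // mulmx1.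
  by [].
move=> hS SK; exists (invmx h); split; first exact: SO3_invmx.
move=> g; rewrite invmxK -SK Snat //.
by rewrite !mulmxA SO3_mulVmx // mul1mx -mulmxA SO3_mulVmx // mulmx1.
Qed.

Lemma in_class_act S H (K : 'M[R]_3 -> Prop) h : conj_natural S -> inH4 H -> SO3 h ->
  in_class (S (act4 h H)) K -> in_class (S H) K.
Proof.
move=> Snat HH hS /(in_class_natural _ Snat (act4_inH4 hS HH))[k kS kK].
apply/(in_class_natural _ Snat HH); exists (k *m h); first exact: SO3_mul.
by move=> g; rewrite act4M.
Qed.

End TensorAction.

(** * Subgroups of O(2) *)

Section AxialGroups.
Variable R : realType.
Implicit Types (g h : 'M[R]_3) (A B : tensor2 R) (T H : tensor4 R).

Lemma subgroup_sym4 H : subgroup (sym4 H).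
Proof.
split; first by move=> g [].
split; first by split; [exact: SO3_1|rewrite act4_1].
split=> [a b [aS aH] [bS bH]|a [aS aH]].
  by split; [exact: SO3_mul|rewrite act4M // bH].
by split; [exact: SO3_invmx|rewrite -{1}aH act4K].
Qed.

Lemma subgroup_sym2 A : subgroup (sym2 A).
Proof.
split; first by move=> g [].
split; first by split; [exact: SO3_1|rewrite act2_1].
split=> [a b [aS aA] [bS bA]|a [aS aA]].
  by split; [exact: SO3_mul|rewrite act2M // bA].
by split; [exact: SO3_invmx|rewrite -{1}aA act2K].
Qed.

Lemma det2 (M : 'M[R]_2) : \det M = M 0 0 * M 1 1 - M 0 1 * M 1 0.
Proof.
rewrite (expand_det_row _ 0) !big_ord_recl big_ord0 /cofactor !det_mx11 !mxE /=.
rewrite (_ : lift 0 0 = 1); last exact: val_inj.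
rewrite (_ : lift 1 0 = 0); last exact: val_inj.
by rewrite expr0 mul1r addr0 expr1 mulN1r mulrN.
Qed.

Lemma det3 g : \det g =
  g o0 o0 * (g o1 o1 * g o2 o2 - g o1 o2 * g o2 o1)
  - g o0 o1 * (g o1 o0 * g o2 o2 - g o1 o2 * g o2 o0)
  + g o0 o2 * (g o1 o0 * g o2 o1 - g o1 o1 * g o2 o0).
Proof.
rewrite (expand_det_row _ o0) sum3 /cofactor !det2 !mxE.
have -> : lift o0 0 = o1 by apply: val_inj.
have -> : lift o0 1 = o2 by apply: val_inj.
have -> : lift o1 0 = o0 by apply: val_inj.
have -> : lift o1 1 = o2 by apply: val_inj.
have -> : lift o2 0 = o0 by apply: val_inj.
have -> : lift o2 1 = o1 by apply: val_inj.
by rewrite /=; ring.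
Qed.

Lemma generated_sub (S : 'M[R]_3 -> Prop) g : S g -> generated S g.
Proof. by move=> Sg G _; apply. Qed.

Lemma generated_mul (S : 'M[R]_3 -> Prop) g h :
  generated S g -> generated S h -> generated S (g *m h).
Proof.
move=> Sg Sh G Gs GS; have [_ [_ [Gm _]]] := Gs.
by apply: Gm; [apply: Sg|apply: Sh].
Qed.

Lemma generated_1 (S : 'M[R]_3 -> Prop) : generated S 1%:M.
Proof. by move=> G [_ [G1 _]]. Qed.

Definition dg (a b : R) : 'M[R]_3 :=
  \matrix_(i, j) if i == j then (if i == o2 then b else a) else 0.

Lemma ap_rotz0 (c s : R) u : ap (rotz c s) u o0 = c * u o0 - s * u o1.
Proof. by rewrite /ap sum3 !mxE /=; ring. Qed.

Lemma ap_rotz1 (c s : R) u : ap (rotz c s) u o1 = s * u o0 + c * u o1.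
Proof. by rewrite /ap sum3 !mxE /=; ring. Qed.

Lemma ap_rotz2 (c s : R) u : ap (rotz c s) u o2 = u o2.
Proof. by rewrite /ap sum3 !mxE /=; ring. Qed.

Lemma ap_rotx0 u : ap (rotx_pi R) u o0 = u o0.
Proof. by rewrite /ap sum3 !mxE /=; ring. Qed.

Lemma ap_rotx1 u : ap (rotx_pi R) u o1 = - u o1.
Proof. by rewrite /ap sum3 !mxE /=; ring. Qed.

Lemma ap_rotx2 u : ap (rotx_pi R) u o2 = - u o2.
Proof. by rewrite /ap sum3 !mxE /=; ring. Qed.

Definition ap_rotz c s u := (ap_rotz0 c s u, ap_rotz1 c s u, ap_rotz2 c s u).
Definition ap_rotx u := (ap_rotx0 u, ap_rotx1 u, ap_rotx2 u).

Lemma SO3_rotz c s : c ^+ 2 + s ^+ 2 = 1 -> SO3 (rotz c s : 'M[R]_3).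
Proof.
move=> cs1; split; last by rewrite det3 !mxE /= -[RHS]cs1; ring.
apply/matrixP; do 2! elim/ord3_ind; rewrite !mxE sum3 !mxE /= ?mulr1n ?mulr0n.
all: try ring.
all: by rewrite -[RHS]cs1; ring.
Qed.

Lemma SO3_rotx_pi : SO3 (rotx_pi R).
Proof.
split; last by rewrite det3 !mxE /=; ring.
by apply/matrixP; do 2! elim/ord3_ind; rewrite !mxE sum3 !mxE /=; ring.
Qed.

Lemma O2_rotz c s : c ^+ 2 + s ^+ 2 = 1 -> O2 (rotz c s : 'M[R]_3).
Proof. by move=> cs1; apply: generated_sub; left; exists c, s. Qed.

Lemma O2_rotx_pi : O2 (rotx_pi R).
Proof. by apply: generated_sub; right. Qed.

Lemma O2_SO3 g : O2 g -> SO3 g.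
Proof.
apply; first split=> //.
  split; first exact: SO3_1.
  by split; [exact: SO3_mul|exact: SO3_invmx].
by move=> x [[c [s [cs1 ->]]]|->]; [exact: SO3_rotz|exact: SO3_rotx_pi].
Qed.

(** The axis is kept or reversed; by the determinant the planar block is then a rotation or a
    reflection respectively. *)
Lemma SO3_block g : SO3 g ->
  g o0 o2 = 0 -> g o1 o2 = 0 -> g o2 o0 = 0 -> g o2 o1 = 0 ->
  exists c s, c ^+ 2 + s ^+ 2 = 1 /\
    (g = rotz c s \/ g = rotz c s *m rotx_pi R).
Proof.
move=> [/matrixP gTg dg] g02 g12 g20 g21.
have := gTg o0 o0; have := gTg o1 o1; have := gTg o2 o2; have := gTg o0 o1.
rewrite !mxE !sum3 !mxE /= ?mulr1n ?mulr0n g02 g12 g20 g21 => e01 e22 e11 e00.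
rewrite det3 g02 g12 g20 g21 in dg.
exists (g o0 o0), (g o1 o0); split; first by rewrite -e00; ring.
have /orP[/eqP e|/eqP e] : (g o2 o2 == 1) || (g o2 o2 == -1).
- by rewrite -subr_eq0 -[X in _ || X]subr_eq0 -mulf_eq0; apply/eqP; nra.
- left; rewrite e in dg.
  (* The sum equals the squared norms of the two block columns minus twice the block determinant,
     that is 1 + 1 - 2. *)
  have /eqP : (g o1 o1 - g o0 o0) ^+ 2 + (g o0 o1 + g o1 o0) ^+ 2 = 0 by nra.
  rewrite paddr_eq0 ?sqr_ge0 // !sqrf_eq0 => /andP[/eqP d0 /eqP d1].
  apply/matrixP; do 2! elim/ord3_ind; rewrite !mxE /= ?g02 ?g12 ?g20 ?g21 ?e //.
    by lra.
  by lra.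
- right; rewrite e in dg.
  have /eqP : (g o1 o1 + g o0 o0) ^+ 2 + (g o0 o1 - g o1 o0) ^+ 2 = 0 by nra.
  rewrite paddr_eq0 ?sqr_ge0 // !sqrf_eq0 => /andP[/eqP d0 /eqP d1].
  apply/matrixP; do 2! elim/ord3_ind; rewrite !mxE sum3 !mxE /= ?g02 ?g12 ?g20 ?g21 ?e //.
  all: by lra.
Qed.

Lemma act2_fix g A : SO3 g -> act2 g A = A <-> g *m A = A *m g.
Proof.
move=> gS; rewrite act2_mx //; split=> [{2}<-|->].
  by rewrite -!mulmxA gS.1 mulmx1.
by rewrite -mulmxA SO3_mulmxT // mulmx1.
Qed.

(** Being fixed means commuting with [g], and in the commutator the entries linking the axis to the
    plane carry the factor [b - a] up to sign. *)
Lemma dg_fix_block a b g : a != b -> SO3 g -> act2 g (dg a b) = dg a b ->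
  [/\ g o0 o2 = 0, g o1 o2 = 0, g o2 o0 = 0 & g o2 o1 = 0].
Proof.
move=> ab gS /(act2_fix _ gS) /matrixP gA.
have ba : b - a != 0 by rewrite subr_eq0 eq_sym.
split; apply/eqP; rewrite -(mulIr_eq0 _ (mulIf ba)).
- by have := gA o0 o2; rewrite !mxE !sum3 !mxE /= => e; apply/eqP; lra.
- by have := gA o1 o2; rewrite !mxE !sum3 !mxE /= => e; apply/eqP; lra.
- by have := gA o2 o0; rewrite !mxE !sum3 !mxE /= => e; apply/eqP; lra.
- by have := gA o2 o1; rewrite !mxE !sum3 !mxE /= => e; apply/eqP; lra.
Qed.

Lemma dg_fix_O2 a b g : a != b -> SO3 g -> act2 g (dg a b) = dg a b -> O2 g.
Proof.
move=> ab gS gA; have [g02 g12 g20 g21] := dg_fix_block ab gS gA.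
have [c [s [cs1 [->|->]]]] := SO3_block gS g02 g12 g20 g21.
  exact: O2_rotz.
by apply: generated_mul; [apply: O2_rotz|apply: O2_rotx_pi].
Qed.

Lemma O2_fix_dg a b g : O2 g -> act2 g (dg a b) = dg a b.
Proof.
move=> gO; suff : sym2 (dg a b) g by case.
apply: gO; first exact: subgroup_sym2.
move=> _ [[c [s [cs1 ->]]]|->]; split.
- exact: SO3_rotz.
- rewrite act2_fix; last exact: SO3_rotz.
  by apply/matrixP; do 2! elim/ord3_ind; rewrite !mxE !sum3 !mxE /=; ring.
- exact: SO3_rotx_pi.
- rewrite act2_fix; last exact: SO3_rotx_pi.
  by apply/matrixP; do 2! elim/ord3_ind; rewrite !mxE !sum3 !mxE /=; ring.
Qed.

Lemma SO3_fix_dg a g : SO3 g -> act2 g (dg a a) = dg a a.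
Proof.
move=> gS; rewrite act2_fix //.
by apply/matrixP; do 2! elim/ord3_ind; rewrite !mxE !sum3 !mxE /=; ring.
Qed.

(** The half-turn about x kills the entries 01 and 02; a rotation about z with nonzero sine then
    kills 12 and equates 00 with 11. One such rotation exists in each of [D3], [D4] and [O2]. *)
Lemma fix_dg A c s : inSym2 A -> c ^+ 2 + s ^+ 2 = 1 -> s != 0 ->
  act2 (rotz c s) A = A -> act2 (rotx_pi R) A = A ->
  exists a b, A = dg a b.
Proof.
move=> /matrixP AS cs1 s0 /(act2_fix _ (SO3_rotz cs1)) /matrixP rA.
move=> /(act2_fix _ SO3_rotx_pi) /matrixP xA.
exists (A o0 o0), (A o2 o2).
have e01 : A o0 o1 = 0.
  by have := xA o0 o1; rewrite !mxE !sum3 !mxE /= => e; lra.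
have e02 : A o0 o2 = 0.
  by have := xA o0 o2; rewrite !mxE !sum3 !mxE /= => e; lra.
have e10 : A o1 o0 = 0 by have := AS o1 o0; rewrite mxE e01.
have e20 : A o2 o0 = 0 by have := AS o2 o0; rewrite mxE e02.
have e12 : A o1 o2 = 0.
  apply/eqP; rewrite -(mulIr_eq0 _ (mulIf s0)); apply/eqP.
  by have := rA o0 o2; rewrite !mxE !sum3 !mxE /= e02 => e; lra.
have e21 : A o2 o1 = 0 by have := AS o2 o1; rewrite mxE e12.
have e11 : A o1 o1 = A o0 o0.
  apply/eqP; rewrite -subr_eq0 -(mulIr_eq0 _ (mulIf s0)); apply/eqP.
  by have := rA o0 o1; rewrite !mxE !sum3 !mxE /= e01 => e; lra.
by apply/matrixP; do 2! elim/ord3_ind; rewrite !mxE.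
Qed.

End AxialGroups.

(** * Tensors of weights 0, 3 and 4 *)

Section NormalForm.
Variable R : realType.
Implicit Types (g h : 'M[R]_3) (A B : tensor2 R) (T H : tensor4 R).

(* [p], [(u + p / 4, v)] and [(w, t)] are the coordinates of weight 0, 4 and 3
   under rotations about the axis [o2]. *)
Definition nform (p u v w t : R) : tensor4 R :=
  [ffun x => let: (i, j, k, l) := x in
   match ((i == o2) + (j == o2) + (k == o2) + (l == o2))%N,
         ((i == o1) + (j == o1) + (k == o1) + (l == o1))%N with
   | 0, 0 | 0, 4 => - p - u
   | 0, 1 => v
   | 0, 2 => u
   | 0, 3 => - v
   | 1, 0 => w
   | 1, 1 => t
   | 1, 2 => - w
   | 1, 3 => - t
   | 2, 0 | 2, 2 => p
   | 4, _ => - 2 * p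
   | _, _ => 0
   end].

(** Of the nine dimensions of H^4, the four conditions remove the weights 1 and 2, two dimensions
    each; five parameters remain. *)
Lemma nformP H : inH4 H ->
  H (o2, o2, o0, o1) = 0 -> H (o2, o2, o0, o2) = 0 -> H (o2, o2, o1, o2) = 0 ->
  H (o2, o2, o0, o0) = H (o2, o2, o1, o1) ->
  H = nform (H (o2, o2, o0, o0)) (H (o0, o0, o1, o1)) (H (o0, o0, o0, o1))
            (H (o0, o0, o0, o2)) (H (o0, o0, o1, o2)).
Proof.
move=> /inH4P[s1 s2 s3 trH] z01 z02 z12 ze.
(* Oriented instances of the symmetries that sort the indices. The six trace equations then express
   six of the fifteen sorted components through the others. *)
pose sorts := (s1 o1 o0, s1 o2 o0, s1 o2 o1,
  (fun i => s2 i o1 o0), (fun i => s2 i o2 o0), (fun i => s2 i o2 o1),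
  (fun i j => s3 i j o1 o0), (fun i j => s3 i j o2 o0), (fun i j => s3 i j o2 o1)).
have t00 := trH o0 o0; have t11 := trH o1 o1; have t22 := trH o2 o2.
have t01 := trH o0 o1; have t02 := trH o0 o2; have t12 := trH o1 o2.
rewrite ?sum3 ?sorts in t00 t11 t22 t01 t02 t12 z01 z02 z12 ze.
rewrite -ze z01 z02 z12 !addr0 in t22 t01 t02 t12 t11.
have a1 (x y z : R) : x + y + z = 0 -> x = - z - y by move=> ?; lra.
have a2 (x y z : R) : y + x + z = 0 -> x = - z - y by move=> ?; lra.
have a3 (x y : R) : x + x + y = 0 -> y = - 2 * x by move=> ?; lra.
have a4 (x y : R) : x + y = 0 -> y = - x by move=> ?; lra.
have e0000 := a1 _ _ _ t00; have e1111 := a2 _ _ _ t11.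
have e2222 := a3 _ _ t22; have e0111 := a4 _ _ t01.
have e0112 := a4 _ _ t02; have e1112 := a4 _ _ t12.
apply: tensor4P; do 4! elim/ord3_ind; rewrite [RHS]ffunE /= ?sorts.
all: clear sorts s1 s2 s3 trH.
all: by rewrite ?(e0000, e1111, e2222, e0111, e0112, e1112).
Qed.

(** [dg a b] is [a] times the identity plus [b - a] times z (x) z, and tracelessness kills the first
    term. *)
Lemma dcontr42_dg H a b i j : inH4 H ->
  dcontr42 H (dg a b) i j = (b - a) * H (o2, o2, i, j).
Proof.
move=> HH; rewrite mxE !sum3 !mxE /= !mulr0 ?addr0 ?add0r.
rewrite !(inH4_pair_swap i j) //; have [_ trH] := HH.
have := trH i j; rewrite sum3.
move: (H _) (H _) (H _) => x y z /(canRL (addKr _)) ->; ring.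
Qed.

Lemma dcontr42_dg_nform H a b c d : inH4 H -> a != b ->
  dcontr42 H (dg a b) = dg c d -> exists p u v w t, H = nform p u v w t.
Proof.
move=> HH ab /matrixP HA.
have ba : b - a != 0 by rewrite subr_eq0 eq_sym.
have E i j : H (o2, o2, i, j) = dg c d i j / (b - a).
  by rewrite -HA dcontr42_dg // mulrC mulKf.
exists (H (o2, o2, o0, o0)), (H (o0, o0, o1, o1)), (H (o0, o0, o0, o1)),
  (H (o0, o0, o0, o2)), (H (o0, o0, o1, o2)).
by apply: nformP => //; rewrite !E !mxE /= ?mul0r.
Qed.

Lemma nform_inj p u v w t p' u' v' w' t' :
  nform p u v w t = nform p' u' v' w' t' :> tensor4 R ->
  [/\ p = p', u = u', v = v', w = w' & t = t'].
Proof.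
move=> /ffunP E.
have := E (o2, o2, o0, o0); have := E (o0, o0, o1, o1).
have := E (o0, o0, o0, o1); have := E (o0, o0, o0, o2).
by have := E (o0, o0, o1, o2); rewrite !ffunE.
Qed.

(** For [c = cos x] and [s = sin x], [C4], [S4], [C3], [S3] are the cosines and sines of 4x and 3x:
    the pair [(u + p / 4, v)] turns by -4x and [(w, t)] by 3x. *)
Lemma nform_rotz p u v w t c s :
  inH4 (nform p u v w t : tensor4 R) -> c ^+ 2 + s ^+ 2 = 1 ->
  let C4 := c ^+ 4 - 6 * c ^+ 2 * s ^+ 2 + s ^+ 4 in
  let S4 := 4 * c ^+ 3 * s - 4 * c * s ^+ 3 in
  let C3 := c ^+ 3 - 3 * c * s ^+ 2 in
  let S3 := 3 * c ^+ 2 * s - s ^+ 3 in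
  act4 (rotz c s) (nform p u v w t) =
  nform p ((u + p / 4) * C4 + v * S4 - p / 4) (v * C4 - (u + p / 4) * S4)
    (w * C3 - t * S3) (w * S3 + t * C3).
Proof.
move=> NH cs1 /=; have rS := SO3_rotz cs1.
have s2 : s ^+ 2 = 1 - c ^+ 2 by rewrite -cs1 addrC addKr.
have HH := act4_inH4 rS NH.
have E (i j k l : 'I_3) := act4E (nform p u v w t) i j k l rS.
rewrite [LHS]nformP //.
- congr nform; rewrite E !ap_rotz !ffunE /=; first by ring: s2.
  - by field: s2.
  - by field: s2.
  - by ring: s2.
  - by ring: s2.
- by rewrite E !ap_rotz !ffunE /=; ring.
- by rewrite E !ap_rotz !ffunE /=; ring.
- by rewrite E !ap_rotz !ffunE /=; ring.
- by rewrite !E !ap_rotz !ffunE /=; ring.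
Qed.

Lemma nform_rotx p u v w t :
  act4 (rotx_pi R) (nform p u v w t) = nform p u (- v) (- w) t.
Proof.
apply: tensor4P => i j k l; rewrite act4E; last exact: SO3_rotx_pi.
move: i j k l; do 4! elim/ord3_ind; rewrite !ap_rotx !ffunE /=.
all: by rewrite ?opprK ?oppr0.
Qed.

(** With [X = u + p / 4], the last two entries combine into [d12 - i d02 = 4 (X - i v) (t + i w)], a
    product of the weight 4 and weight 3 coordinates. *)
Lemma d2_nform p u v w t :
  let N : tensor4 R := nform p u v w t in
  [/\ d2 N o0 o0 = (p + u) ^+ 2 + 3 * u ^+ 2 + 3 * p ^+ 2 + 4 * v ^+ 2
                   + 6 * (w ^+ 2 + t ^+ 2),
      d2 N o2 o2 = 10 * p ^+ 2 + 4 * (w ^+ 2 + t ^+ 2),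
      d2 N o0 o2 = 4 * (v * t - (u + p / 4) * w) &
      d2 N o1 o2 = 4 * (v * w + (u + p / 4) * t)].
Proof.
move=> N; rewrite /N !d2E !sum3 !ffunE /=; split.
- by ring.
- by ring.
- by field.
- by field.
Qed.

End NormalForm.

(** * Angles that kill a coordinate, and symmetries outside O(2) *)

Section AnglesAndExtraSymmetries.
Variable R : realType.
Implicit Types (g h : 'M[R]_3) (A B : tensor2 R) (T H : tensor4 R).

Lemma poly_root_between (p : {poly R}) a b :
  a <= b -> p.[a] * p.[b] <= 0 -> exists x, p.[x] = 0.
Proof.
move=> ab pab; have [pb|pb] := leP 0 p.[b].
  have [pa|pa] := leP p.[a] 0.
    have [||x _ /eqP] := @poly_ivt R p a b => //; last by exists x.
    by rewrite pa.
  (* Here [p.[a]] is positive, so the product condition makes [b] itself a root. *)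
  exists b; apply/eqP; rewrite eq_le pb andbT.
  by move: pab; rewrite pmulr_rle0.
have [||x _ /eqP] := @poly_ivt R (- p) a b => //.
  rewrite !hornerN oppr_le0 oppr_ge0 (ltW pb) andbT.
  by move: pab; rewrite nmulr_lle0.
by rewrite hornerN => /eqP; rewrite oppr_eq0 => /eqP px; exists x.
Qed.

(** Normalising [(x, 1)] turns a root [x] of a dehomogenised form in [c], [s] into an angle. *)
Lemma circle_point (x : R) : exists2 n, n != 0 &
  (x / n) ^+ 2 + (1 / n) ^+ 2 = 1.
Proof.
have x1 : 0 < x ^+ 2 + 1 by rewrite ltr_wpDl ?sqr_ge0.
exists (Num.sqrt (x ^+ 2 + 1)); first by rewrite gt_eqF // sqrtr_gt0.
by rewrite !exprMn -mulrDl exprVn sqr_sqrtr ?ltW // expr1n divff // gt_eqF.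
Qed.

(* Dehomogenised at [s = 1], the quartic form takes the values [B] at [0] and
   [-4 B] at [1]. *)
Lemma quartic_angle (A B : R) : exists c s, c ^+ 2 + s ^+ 2 = 1 /\
  B * (c ^+ 4 - 6 * c ^+ 2 * s ^+ 2 + s ^+ 4) -
  A * (4 * c ^+ 3 * s - 4 * c * s ^+ 3) = 0.
Proof.
pose p : {poly R} := B *: ('X^4 - 6 *: 'X^2 + 1) - A *: (4 *: 'X^3 - 4 *: 'X).
have pE x : p.[x] = B * (x ^+ 4 - 6 * x ^+ 2 + 1) - A * (4 * x ^+ 3 - 4 * x).
  by rewrite /p !hornerE.
have [||x px] := @poly_root_between p 0 1 => //.
  by rewrite !pE; nra.
have [n n0 n1] := circle_point x; exists (x / n), (1 / n); split=> //.
by rewrite -[RHS](mul0r (n ^- 4)) -px pE; field.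
Qed.

Lemma cubic_angle (A B : R) : exists c s, c ^+ 2 + s ^+ 2 = 1 /\
  A * (c ^+ 3 - 3 * c * s ^+ 2) - B * (3 * c ^+ 2 * s - s ^+ 3) = 0.
Proof.
pose p : {poly R} := A *: ('X^3 - 3 *: 'X) - B *: (3 *: 'X^2 - 1).
have pE x : p.[x] = A * (x ^+ 3 - 3 * x) - B * (3 * x ^+ 2 - 1).
  by rewrite /p !hornerE.
have q3 : Num.sqrt 3 ^+ 2 = 3 :> R by rewrite sqr_sqrtr.
(* Both endpoints are roots of [x ^+ 3 - 3 * x], so [A] drops out and the values are [B] and
   [- 8 * B]. *)
have [||x px] := @poly_root_between p 0 (Num.sqrt 3) => //.
- by rewrite sqrtr_ge0.
- by rewrite !pE; set q := Num.sqrt 3 in q3 *; rewrite (exprS q 2) q3; nra.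
have [n n0 n1] := circle_point x; exists (x / n), (1 / n); split=> //.
(* The form is homogeneous of degree 3, so normalisation divides its value by [n ^+ 3]. *)
by rewrite -[RHS](mul0r (n ^- 3)) -px pE; field.
Qed.

Lemma O2_subgroup : subgroup (@O2 R).
Proof.
split; first exact: O2_SO3.
split; first exact: generated_1.
split; first by move=> a b; apply: generated_mul.
move=> a aO; move=> G Gs GS; have [_ [_ [_ GV]]] := Gs.
by apply: GV; apply: aO.
Qed.

Lemma D4_sub_O2 g : D4 g -> O2 g.
Proof.
apply; first exact: O2_subgroup.
by move=> _ [->|->]; [apply: O2_rotz; ring|apply: O2_rotx_pi].
Qed.

Lemma D3_circle : (- 2^-1) ^+ 2 + (Num.sqrt 3 / 2) ^+ 2 = 1 :> R.
Proof. by rewrite exprMn sqr_sqrtr //; field. Qed.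

Lemma D3_sub_O2 g : D3 g -> O2 g.
Proof.
apply; first exact: O2_subgroup.
by move=> _ [->|->]; [apply: O2_rotz; exact: D3_circle|apply: O2_rotx_pi].
Qed.

(** The shape of rotations that preserve the x-axis up to sign; those with [b] nonzero tilt the
    z-axis and supply the symmetries outside [O2]. *)
Definition xblock (e a b c d : R) : 'M[R]_3 :=
  \matrix_(i < 3, j < 3)
    match nat_of_ord i, nat_of_ord j with
    | 0, 0 => e | 1, 1 => a | 1, 2 => b | 2, 1 => c | 2, 2 => d
    | _, _ => 0 end.

Lemma ap_xblock0 e a b c d u : ap (xblock e a b c d) u o0 = e * u o0.
Proof. by rewrite /ap sum3 !mxE /=; ring. Qed.

Lemma ap_xblock1 e a b c d u : ap (xblock e a b c d) u o1 = a * u o1 + b * u o2.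
Proof. by rewrite /ap sum3 !mxE /=; ring. Qed.

Lemma ap_xblock2 e a b c d u : ap (xblock e a b c d) u o2 = c * u o1 + d * u o2.
Proof. by rewrite /ap sum3 !mxE /=; ring. Qed.

Definition ap_xblock e a b c d u :=
  (ap_xblock0 e a b c d u, ap_xblock1 e a b c d u, ap_xblock2 e a b c d u).

Lemma SO3_xblock e a b c d : e ^+ 2 = 1 -> a ^+ 2 + c ^+ 2 = 1 ->
  b ^+ 2 + d ^+ 2 = 1 -> a * b + c * d = 0 -> e * (a * d - b * c) = 1 ->
  SO3 (xblock e a b c d).
Proof.
move=> e1 ac1 bd1 abcd det1; split; last by rewrite det3 !mxE /= -[RHS]det1; ring.
apply/matrixP; do 2! elim/ord3_ind; rewrite !mxE sum3 !mxE /= ?mulr1n ?mulr0n.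
all: try ring.
- by rewrite -[RHS]e1; ring.
- by rewrite -[RHS]ac1; ring.
- by rewrite -[RHS]abcd; ring.
- by rewrite -[RHS]abcd; ring.
- by rewrite -[RHS]bd1; ring.
Qed.

Lemma xblock_notin_O2 e a b c d : b != 0 -> ~ O2 (xblock e a b c d).
Proof.
move=> b0 gO; have := O2_fix_dg 0 1 gO.
have ne01 : 0 != 1 :> R by rewrite eq_sym oner_eq0.
move=> /(dg_fix_block ne01 (O2_SO3 gO)) [_ + _ _].
by rewrite mxE /= => /eqP; rewrite (negPf b0).
Qed.

Lemma O2_proper : exists2 g : 'M[R]_3, SO3 g & ~ O2 g.
Proof.
exists (xblock 1 0 (- 1) 1 0); last by apply: xblock_notin_O2; rewrite oppr_eq0 oner_eq0.
by apply: SO3_xblock; ring.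
Qed.

(** For [u = p] the three coordinate axes play the same role, as for a cube with edges along them;
    the extra symmetry is the quarter-turn about x. *)
Lemma cubic_extra_sym (p : R) : inH4 (nform p p 0 0 0) ->
  exists2 g, sym4 (nform p p 0 0 0) g & ~ O2 g.
Proof.
move=> NH; pose g := xblock 1 0 (- 1) 1 0.
have gS : SO3 g by apply: SO3_xblock; ring.
exists g; last by apply: xblock_notin_O2; rewrite oppr_eq0 oner_eq0.
split=> //; have HH := act4_inH4 gS NH.
have E (i j k l : 'I_3) := act4E (nform p p 0 0 0) i j k l gS.
rewrite [LHS]nformP //.
- by congr nform; rewrite E !ap_xblock !ffunE /=; ring.
all: by rewrite !E !ap_xblock !ffunE /=; ring.
Qed.

(* The extra symmetry is the half-turn about an edge direction of the cube
   having the axis [o2] as a body diagonal. *)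
Lemma trigonal_extra_sym (p t q : R) : q ^+ 2 = 2 -> t = 5 / 4 * q * p ->
  inH4 (nform p (- p / 4) 0 0 t) ->
  exists2 g, sym4 (nform p (- p / 4) 0 0 t) g & ~ O2 g.
Proof.
move=> q2 tE NH; pose g := xblock (- 1) (1 / 3) (- 2 * q / 3) (- 2 * q / 3) (- 1 / 3).
have gS : SO3 g by apply: SO3_xblock; field: q2.
exists g; last first.
  apply: xblock_notin_O2; apply/eqP => q0.
  have {}q0 : q = 0 by lra.
  by move: q2; rewrite q0 expr0n /= => /eqP; rewrite eq_sym pnatr_eq0.
split=> //; have HH := act4_inH4 gS NH.
have E (i j k l : 'I_3) := act4E (nform p (- p / 4) 0 0 t) i j k l gS.
rewrite [LHS]nformP //.
- by congr nform; rewrite E !ap_xblock !ffunE /= ?tE; field: q2.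
all: by rewrite !E !ap_xblock !ffunE /= ?tE; field: q2.
Qed.

End AnglesAndExtraSymmetries.

(** * Symmetry classes *)

Section SymmetryClasses.
Variable R : realType.
Implicit Types (g h : 'M[R]_3) (A B : tensor2 R) (T H : tensor4 R).

Lemma d2_fixed H c s : inH4 H -> c ^+ 2 + s ^+ 2 = 1 -> s != 0 ->
  sym4 H (rotz c s) -> sym4 H (rotx_pi R) -> exists a b, d2 H = dg a b.
Proof.
move=> HH cs1 s0 rH xH; apply: (fix_dg (d2_sym HH) cs1 s0).
  exact: Cov2_fix (Cov2_d2 H) rH.
exact: Cov2_fix (Cov2_d2 H) xH.
Qed.

Lemma quad_form_sym (p u : R) : inH4 (nform p u 0 0 0) ->
  sym4 (nform p u 0 0 0) (rotz 0 1) /\ sym4 (nform p u 0 0 0) (rotx_pi R).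
Proof.
move=> NH; split; split.
- by apply: SO3_rotz; ring.
- by rewrite nform_rotz //; [congr nform; field|ring].
- exact: SO3_rotx_pi.
- by rewrite nform_rotx !oppr0.
Qed.

(** The value [u = - p / 4] cancels the weight 4 part, and a third of a turn leaves weight 3
    unchanged. *)
Lemma tri_form_sym (p t : R) : inH4 (nform p (- p / 4) 0 0 t) ->
  sym4 (nform p (- p / 4) 0 0 t) (rotz (- 2^-1) (Num.sqrt 3 / 2)) /\
  sym4 (nform p (- p / 4) 0 0 t) (rotx_pi R).
Proof.
have q3 : Num.sqrt 3 ^+ 2 = 3 :> R by rewrite sqr_sqrtr.
move=> NH; split; split.
- by apply: SO3_rotz; exact: D3_circle.
- by rewrite nform_rotz //; [congr nform; field: q3|exact: D3_circle].
- exact: SO3_rotx_pi.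
- by rewrite nform_rotx !oppr0.
Qed.

Lemma sqrt3_half_neq0 : Num.sqrt 3 / 2 != 0 :> R.
Proof. by rewrite mulf_neq0 ?invr_eq0 ?pnatr_eq0 // gt_eqF // sqrtr_gt0. Qed.

(** The rotation about z lies in [O2], so conjugation by it preserves [O2]. *)
Lemma sym_sub_O2_act H c s : inH4 H -> c ^+ 2 + s ^+ 2 = 1 ->
  (forall g, sym4 H g -> O2 g) ->
  forall g, sym4 (act4 (rotz c s) H) g -> O2 g.
Proof.
move=> HH cs1 symO g; have rS := SO3_rotz cs1.
have rO := O2_rotz cs1; have [_ [_ [_ OV]]] := O2_subgroup R.
move=> /(sym4_natural _ rS HH) /symO gO.
set r := rotz c s in rS rO gO *.
rewrite (_ : g = r *m (invmx r *m g *m r) *m invmx r).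
  by apply: generated_mul; [apply: generated_mul|apply: OV].
by rewrite !mulmxA SO3_mulmxV // mul1mx -mulmxA SO3_mulmxV // mulmx1.
Qed.

Lemma quad_form_d2 (p u : R) : inH4 (nform p u 0 0 0) ->
  (forall g, sym4 (nform p u 0 0 0) g -> O2 g) ->
  exists a b, a != b /\ d2 (nform p u 0 0 0) = dg a b.
Proof.
move=> NH symO; have [rN xN] := quad_form_sym NH.
have [||a [b d2E']] := d2_fixed NH _ _ rN xN; [by ring|exact: oner_neq0|].
exists a, b; split=> //; apply/eqP=> ab.
have [] := d2_nform p u 0 0 0; rewrite d2E' !mxE /= -ab => e1 e2 _ _.
(* Half the difference of the diagonal entries 00 and 22 of [d2]. Both roots give a cubic or zero
   tensor, in positions an eighth of a turn apart. *)
have /eqP : (u - p) * (2 * u + 3 * p) = 0 by nra.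
rewrite mulf_eq0 => /orP[/eqP up|/eqP up].
  have E : u = p by lra.
  rewrite E in NH symO.
  by have [g gN] := cubic_extra_sym NH; apply; apply: symO.
(* [r] is the cosine and sine of an eighth of a turn, which reverses the weight 4 coordinate
   [u + p / 4] and so sends [u = - 3 / 2 * p] to [u = p]. *)
pose r : R := Num.sqrt 2^-1.
have r2 : r ^+ 2 = 2^-1 by rewrite sqr_sqrtr // invr_ge0.
have cs1 : r ^+ 2 + r ^+ 2 = 1 by rewrite r2; field.
have hS := SO3_rotz cs1.
have NE : act4 (rotz r r) (nform p u 0 0 0) = nform p p 0 0 0.
  have uE : u = - 3 / 2 * p by lra.
  have C4 : r ^+ 4 - 6 * r ^+ 2 * r ^+ 2 + r ^+ 4 = - 1.
    by transitivity (- 4 * (r ^+ 2) ^+ 2); [ring|rewrite r2; field].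
  by rewrite nform_rotz // C4 uE; congr nform; field.
have := cubic_extra_sym (p := p); rewrite -NE => -[|g gN].
  exact: act4_inH4.
by apply; apply: (sym_sub_O2_act NH cs1 symO).
Qed.

Lemma tri_form_d2 (p t : R) : inH4 (nform p (- p / 4) 0 0 t) ->
  (forall g, sym4 (nform p (- p / 4) 0 0 t) g -> O2 g) ->
  exists a b, a != b /\ d2 (nform p (- p / 4) 0 0 t) = dg a b.
Proof.
move=> NH symO; have [rN xN] := tri_form_sym NH.
have [a [b d2E']] := d2_fixed NH (D3_circle R) sqrt3_half_neq0 rN xN.
exists a, b; split=> //; apply/eqP=> ab.
have [] := d2_nform p (- p / 4) 0 0 t; rewrite d2E' !mxE /= -ab => e1 e2 _ _.
have tp : 8 * t ^+ 2 = 25 * p ^+ 2 by nra.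
(* [q] is the square root of 2 carrying the sign of [t / p], so both signs are treated at once; for
   [p = 0] also [t = 0] and either root will do. *)
have [q q2 tE] : exists2 q, q ^+ 2 = 2 & t = 5 / 4 * q * p.
  have [p0|p0] := eqVneq p 0.
    exists (Num.sqrt 2); first by rewrite sqr_sqrtr.
    by apply/eqP; rewrite p0 mulr0 -sqrf_eq0; apply/eqP; move: tp; rewrite p0; lra.
  exists (4 / 5 * t / p); last by field.
  have -> : (4 / 5 * t / p) ^+ 2 = 2 / 25 * (8 * t ^+ 2) / p ^+ 2 by field.
  by rewrite tp; field.
by have [g gN] := trigonal_extra_sym q2 tE NH; apply; apply: symO.
Qed.

(** * Symmetry groups of the normal forms *)

Lemma rotz_mul (c s c' s' : R) :
  rotz c s *m rotz c' s' = rotz (c * c' - s * s') (c * s' + s * c').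
Proof.
by apply/matrixP; do 2! elim/ord3_ind; rewrite !mxE sum3 !mxE /=; ring.
Qed.

Lemma rotz1 : rotz 1 0 = 1%:M :> 'M[R]_3.
Proof. by apply/matrixP; do 2! elim/ord3_ind; rewrite !mxE /= ?oppr0. Qed.

Lemma D4_rotz (c s : R) : c ^+ 2 + s ^+ 2 = 1 -> c * s = 0 -> D4 (rotz c s).
Proof.
have D1 : D4 (rotz 0 1 : 'M[R]_3) by apply: generated_sub; left.
have D2 : D4 (rotz (- 1) 0 : 'M[R]_3).
  rewrite (_ : rotz _ _ = rotz 0 1 *m rotz 0 1); first exact: generated_mul.
  by rewrite rotz_mul; congr rotz; ring.
have D3 : D4 (rotz 0 (- 1) : 'M[R]_3).
  rewrite (_ : rotz _ _ = rotz (-1) 0 *m rotz 0 1); first exact: generated_mul.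
  by rewrite rotz_mul; congr rotz; ring.
move=> cs1 /eqP; rewrite mulf_eq0 => /orP[/eqP c0|/eqP s0].
  move: cs1; rewrite c0 expr0n add0r => /eqP; rewrite sqrf_eq1.
  by move=> /orP[]/eqP ->.
move: cs1; rewrite s0 expr0n addr0 => /eqP; rewrite sqrf_eq1.
move=> /orP[]/eqP -> //; rewrite rotz1; exact: generated_1.
Qed.

Lemma D3_rotz (c s : R) : c ^+ 2 + s ^+ 2 = 1 -> c ^+ 3 - 3 * c * s ^+ 2 = 1 ->
  D3 (rotz c s).
Proof.
have q3 : Num.sqrt 3 ^+ 2 = 3 :> R by rewrite sqr_sqrtr.
set q := Num.sqrt 3 in q3.
have D1 : D3 (rotz (- 2^-1) (q / 2)) by apply: generated_sub; left.
have D2 : D3 (rotz (- 2^-1) (- (q / 2))).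
  rewrite (_ : rotz _ (- _) = rotz (- 2^-1) (q / 2) *m rotz (- 2^-1) (q / 2)).
    exact: generated_mul.
  by rewrite rotz_mul; congr rotz; field: q3.
move=> cs1 c3; have s2 : s ^+ 2 = 1 - c ^+ 2 by rewrite -cs1 addrC addKr.
(* The hypothesis says that the cosine of the tripled angle is 1, and [4 c^3 - 3 c - 1] factors this
   way. *)
have /eqP : (c - 1) * (2 * c + 1) ^+ 2 = 0.
  transitivity (c ^+ 3 - 3 * c * s ^+ 2 - 1); first by ring: s2.
  by rewrite c3 subrr.
rewrite mulf_eq0 sqrf_eq0 => /orP[/eqP c1|/eqP c1].
  have E : c = 1 by lra.
  have : s ^+ 2 = 0 by rewrite s2 E expr1n subrr.
  move=> /eqP; rewrite sqrf_eq0 E => /eqP ->; rewrite rotz1; exact: generated_1.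
have E : c = - 2^-1 by lra.
have /eqP : s ^+ 2 = (q / 2) ^+ 2 by rewrite s2 E; field: q3.
by rewrite eqf_sqr E => /orP[]/eqP ->.
Qed.

(** An element of [O2] is a rotation about z, possibly times [rotx_pi]. As [rotx_pi] lies in both
    [G] and [K], only the rotations about z need comparing. *)
Lemma sub_O2_ind (G K : 'M[R]_3 -> Prop) :
  subgroup G -> (forall g h, K g -> K h -> K (g *m h)) ->
  G (rotx_pi R) -> K (rotx_pi R) -> (forall g, G g -> O2 g) ->
  (forall c s, c ^+ 2 + s ^+ 2 = 1 -> G (rotz c s) -> K (rotz c s)) ->
  forall g, G g -> K g.
Proof.
move=> [_ [_ [GM GV]]] KM Gx Kx GO GK g Gg.
have ne01 : 0 != 1 :> R by rewrite eq_sym oner_neq0.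
have gS := O2_SO3 (GO g Gg).
have [g02 g12 g20 g21] := dg_fix_block ne01 gS (O2_fix_dg 0 1 (GO g Gg)).
have [c [s [cs1 [E|E]]]] := SO3_block gS g02 g12 g20 g21.
  by rewrite E in Gg *; apply: GK.
rewrite E; apply: KM => //; apply: GK => //.
have := GM _ _ Gg (GV _ Gx); rewrite E -mulmxA SO3_mulmxV ?mulmx1 //.
exact: SO3_rotx_pi.
Qed.

Lemma quad_form_class (p u : R) : inH4 (nform p u 0 0 0) ->
  (forall g, sym4 (nform p u 0 0 0) g -> O2 g) ->
  (forall g, sym4 (nform p u 0 0 0) g <-> D4 g) \/
  (forall g, sym4 (nform p u 0 0 0) g <-> O2 g).
Proof.
move=> NH symO; have [rN xN] := quad_form_sym NH.
have symG := subgroup_sym4 (nform p u 0 0 0).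
(* Without a weight 4 coordinate only weight 0 remains, which all of [O2] fixes. *)
have [up|up] := eqVneq (u + p / 4) 0.
  right=> g; split; first exact: symO.
  apply=> // _ [[c [s [cs1 ->]]]|->] //; split; first exact: SO3_rotz.
  by rewrite nform_rotz // up; congr nform; lra.
left=> g; split; last by apply=> // _ [->|->].
move: g; apply: (sub_O2_ind symG (@generated_mul _ _)) => //.
  by apply: generated_sub; right.
move=> c s cs1 [_]; rewrite nform_rotz // => /nform_inj[_ + _ _ _] => e.
have s2 : s ^+ 2 = 1 - c ^+ 2 by rewrite -cs1 addrC addKr.
apply: D4_rotz => //; apply/eqP; rewrite -sqrf_eq0.
(* Invariance multiplies [u + p / 4] by the cosine of the quadrupled angle, which is
   [1 - 8 (c s)^2]. *)
have /eqP : (u + p / 4) * (c * s) ^+ 2 = 0.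
  have {}e : (u + p / 4) * (c ^+ 4 - 6 * c ^+ 2 * s ^+ 2 + s ^+ 4 - 1) = 0 by lra.
  have <- : (u + p / 4) * (c ^+ 4 - 6 * c ^+ 2 * s ^+ 2 + s ^+ 4 - 1) / - 8 =
     (u + p / 4) * (c * s) ^+ 2 by field: s2.
  by rewrite e mul0r.
by rewrite mulf_eq0 (negPf up).
Qed.

Lemma tri_form_class (p t : R) : t != 0 -> inH4 (nform p (- p / 4) 0 0 t) ->
  (forall g, sym4 (nform p (- p / 4) 0 0 t) g -> O2 g) ->
  forall g, sym4 (nform p (- p / 4) 0 0 t) g <-> D3 g.
Proof.
move=> t0 NH symO; have [rN xN] := tri_form_sym NH.
have symG := subgroup_sym4 (nform p (- p / 4) 0 0 t).
move=> g; split; last by apply=> // _ [->|->].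
move: g; apply: (sub_O2_ind symG (@generated_mul _ _)) => //.
  by apply: generated_sub; right.
move=> c s cs1 [_]; rewrite nform_rotz // => /nform_inj[_ _ _ _].
rewrite mul0r add0r -[RHS]mulr1 => /(mulfI t0) e.
exact: D3_rotz.
Qed.

(** * From a covariant with an axis to the class of [H] *)

Definition tetra_tri_iso H :=
  [\/ in_class (sym4 H) (@D4 R), in_class (sym4 H) (@D3 R) |
      in_class (sym4 H) (@O2 R)].

Lemma tetra_tri_iso_act H h : inH4 H -> SO3 h ->
  tetra_tri_iso (act4 h H) -> tetra_tri_iso H.
Proof.
by move=> HH hS [] /(in_class_act (@sym4_natural R) HH hS) ?;
   [constructor 1|constructor 2|constructor 3].
Qed.

Lemma in_class_refl (G K : 'M[R]_3 -> Prop) :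
  (forall g, G g <-> K g) -> in_class G K.
Proof.
move=> GK; exists 1%:M; split; first exact: SO3_1.
by move=> g; rewrite GK invmx1 mul1mx mulmx1.
Qed.

(** The common core of the two implications towards the class of [H]. The hypothesis on [d2] enters
    through its vanishing weight 1 entries, and the inclusion in [O2] bounds the group of the normal
    form. *)
Lemma tetra_tri_iso_of_axis H a b c d a' b' : inH4 H -> a != b ->
  dcontr42 H (dg a b) = dg c d -> d2 H = dg a' b' ->
  (forall g, sym4 H g -> O2 g) -> tetra_tri_iso H.
Proof.
move=> HH ab HA d2H symO.
have [p [u [v [w [t HE]]]]] := dcontr42_dg_nform HH ab HA.
rewrite HE in HH d2H symO *.
have [_ _] := d2_nform p u v w t; rewrite d2H !mxE /= => e1 e2.
(* The squared modulus of a complex product is the product of the squared moduli. *)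
have /eqP : ((u + p / 4) ^+ 2 + v ^+ 2) * (w ^+ 2 + t ^+ 2) = 0.
  have {}e1 : v * t - (u + p / 4) * w = 0 by lra.
  have {}e2 : v * w + (u + p / 4) * t = 0 by lra.
  transitivity ((v * t - (u + p / 4) * w) ^+ 2 + (v * w + (u + p / 4) * t) ^+ 2).
    by ring.
  by rewrite e1 e2 expr0n addr0.
rewrite mulf_eq0 !paddr_eq0 ?sqr_ge0 // !sqrf_eq0.
case/orP=> /andP[/eqP z1 /eqP z2].
  (* Weight 4 vanishes: a rotation about z makes [w] zero, and the trigonal form, or the weight 0
     form when [t] vanishes too, is left. *)
  have [x [y [xy1 E]]] := cubic_angle w t.
  have rS := SO3_rotz xy1; apply: (tetra_tri_iso_act HH rS).
  have NH := act4_inH4 rS HH; have NO := sym_sub_O2_act HH xy1 symO.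
  move: NH NO; rewrite nform_rotz // z1 z2 !mul0r E addr0 subr0 add0r -mulNr.
  set t' := _ + _ => NH NO.
  have [t0|t0] := eqVneq t' 0.
    rewrite t0 in NH NO *.
    have [] := quad_form_class NH NO => cl.
      by constructor 1; apply: in_class_refl.
    by constructor 3; apply: in_class_refl.
  by constructor 2; apply: in_class_refl; apply: tri_form_class.
(* Weight 3 vanishes: a rotation about z makes [v] zero. *)
have [x [y [xy1 E]]] := quartic_angle (u + p / 4) v.
have rS := SO3_rotz xy1; apply: (tetra_tri_iso_act HH rS).
have NH := act4_inH4 rS HH; have NO := sym_sub_O2_act HH xy1 symO.
move: NH NO; rewrite nform_rotz // z1 z2 !mul0r E addr0 subr0 => NH NO.
have [] := quad_form_class NH NO => cl.
  by constructor 1; apply: in_class_refl.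
by constructor 3; apply: in_class_refl.
Qed.

Lemma O2_fixed_dg A : inSym2 A -> (forall g, O2 g -> act2 g A = A) ->
  exists a b, A = dg a b.
Proof.
move=> AS AO; apply: (@fix_dg _ A 0 1) => //; first by ring.
- exact: oner_neq0.
- by apply: AO; apply: O2_rotz; ring.
- by apply: AO; apply: O2_rotx_pi.
Qed.

Lemma tetra_tri_iso_of_Cov2 H : inH4 H ->
  (forall g, sym_family (Cov2 H) g <-> O2 g) -> tetra_tri_iso H.
Proof.
move=> HH CO.
have Cdg A : Cov2 H A -> exists a b, A = dg a b.
  move=> CA; apply: (O2_fixed_dg (Cov2_sym HH CA)) => g /CO[_]; exact.
have [A [a [b [CA ab AE]]]] : exists A a b, [/\ Cov2 H A, a != b & A = dg a b].
  (* Were all covariants isotropic, a rotation outside [O2] would fix the whole family. *)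
  apply: contrapT => nA; have [g gS] := O2_proper R; apply; apply/CO.
  split=> // A CA; have [a [b AE]] := Cdg A CA; rewrite AE.
  have [ab|ab] := eqVneq a b; first by rewrite ab SO3_fix_dg.
  by case: nA; exists A, a, b.
have [c [d HA]] := Cdg _ (Cov2_dcontr CA); rewrite AE in HA.
have [a' [b' d2H]] := Cdg _ (Cov2_d2 H).
apply: (tetra_tri_iso_of_axis HH ab HA d2H) => g gH; apply/CO.
by split; [case: gH|move=> B CB; apply: Cov2_fix gH].
Qed.

Lemma tetra_tri_iso_of_pair H : inH4 H ->
  (forall g, sym_pair H g <-> O2 g) -> tetra_tri_iso H.
Proof.
move=> HH PO.
have [a [b d2H]] : exists a b, d2 H = dg a b.
  by apply: (O2_fixed_dg (d2_sym HH)) => g /PO[[]].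
have [c [d c3H]] : exists c d, c3 H = dg c d.
  by apply: (O2_fixed_dg (Cov2_sym HH (Cov2_c3 H))) => g /PO[_ []].
have HA : dcontr42 H (dg a b) = dg c d by rewrite -d2H.
(* If [d2] were isotropic, [c3] would vanish by tracelessness and every rotation would fix the
   pair. *)
have ab : a != b.
  apply/eqP=> ab; have [g gS] := O2_proper R; apply; apply/PO.
  have {}c3H : c3 H = dg 0 0.
    apply/matrixP=> i j; rewrite /c3 d2H ab dcontr42_dg // subrr mul0r mxE.
    by case: (i == j); case: (i == o2).
  by split; split=> //; rewrite ?c3H ?d2H ?ab SO3_fix_dg.
apply: (tetra_tri_iso_of_axis HH ab HA d2H) => g gH; apply/PO.
have [gS _] := gH.
by split; split=> //; apply: Cov2_fix HH _ gH; [exact: Cov2_d2|exact: Cov2_c3].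
Qed.

(** * From the class of [H] to its covariants *)

Lemma Cov2_iso_of_d2 H c s a b : inH4 H -> c ^+ 2 + s ^+ 2 = 1 -> s != 0 ->
  sym4 H (rotz c s) -> sym4 H (rotx_pi R) -> a != b -> d2 H = dg a b ->
  (forall g, sym_family (Cov2 H) g <-> O2 g) /\
  (forall g, sym_pair H g <-> O2 g).
Proof.
move=> HH cs1 s0 rH xH ab d2H.
(* Each covariant inherits the rotation and the half-turn of [H], hence is axisymmetric. In the
   other direction, the non-isotropic [d2] confines the groups to [O2]. *)
have Cfix A g : Cov2 H A -> O2 g -> act2 g A = A.
  move=> CA gO.
  have [e [f ->]] := fix_dg (Cov2_sym HH CA) cs1 s0 (Cov2_fix HH CA rH) (Cov2_fix HH CA xH).
  exact: O2_fix_dg.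
split=> g; split.
- move=> [gS gC]; apply: (dg_fix_O2 ab gS); rewrite -d2H.
  by apply: gC; apply: Cov2_d2.
- by move=> gO; split=> [|A CA]; [exact: O2_SO3|exact: Cfix].
- by move=> [[gS gd] _]; apply: (dg_fix_O2 ab gS); rewrite -d2H.
move=> gO; have gS := O2_SO3 gO.
by split; split=> //; apply: Cfix => //; [exact: Cov2_d2|exact: Cov2_c3].
Qed.

(** [dg 0 1] is z (x) z, so [H : (z (x) z)] shares the two symmetries and is axisymmetric, which
    gives the normal form; the half-turn negates [v] and [w]. *)
Lemma fixed_nform H c s : inH4 H -> c ^+ 2 + s ^+ 2 = 1 -> s != 0 ->
  sym4 H (rotz c s) -> sym4 H (rotx_pi R) ->
  exists p u t, H = nform p u 0 0 t.
Proof.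
move=> HH cs1 s0 rH xH.
have ne01 : 0 != 1 :> R by rewrite eq_sym oner_neq0.
have fixB g : O2 g -> sym4 H g ->
    act2 g (dcontr42 H (dg 0 1)) = dcontr42 H (dg 0 1).
  by move=> gO [gS gH]; rewrite -dcontr42_act // gH O2_fix_dg.
have [a [b HA]] := fix_dg (dcontr42_sym (dg 0 1) HH) cs1 s0
  (fixB _ (O2_rotz cs1) rH) (fixB _ (@O2_rotx_pi R) xH).
have [p [u [v [w [t HE]]]]] := dcontr42_dg_nform HH ne01 HA.
exists p, u, t; case: xH => _; rewrite HE nform_rotx => /nform_inj[_ _ ev ew _].
by congr nform; lra.
Qed.

(** Applies to [D4] and [O2] alike, since both contain the quarter-turn; the inclusion in [O2]
    excludes cubic tensors. *)
Lemma quad_Cov2_iso H : inH4 H ->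
  sym4 H (rotz 0 1) -> sym4 H (rotx_pi R) -> (forall g, sym4 H g -> O2 g) ->
  (forall g, sym_family (Cov2 H) g <-> O2 g) /\
  (forall g, sym_pair H g <-> O2 g).
Proof.
move=> HH rH xH symO.
have cs1 : 0 ^+ 2 + 1 ^+ 2 = 1 :> R by ring.
have [p [u [t HE]]] := fixed_nform HH cs1 (oner_neq0 _) rH xH.
(* A quarter-turn moves [t] into the place of [w], which is zero. *)
have t0 : t = 0.
  case: (rH) => _; rewrite HE nform_rotz -?HE // HE => /nform_inj[_ _ _ + _].
  by move=> e; lra.
rewrite HE t0 in HH rH xH symO *.
have [a [b [ab d2H]]] := quad_form_d2 HH symO.
exact: (Cov2_iso_of_d2 HH cs1 (oner_neq0 _) rH xH ab d2H).
Qed.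

Lemma tri_Cov2_iso H : inH4 H -> sym4 H (rotz (- 2^-1) (Num.sqrt 3 / 2)) ->
  sym4 H (rotx_pi R) -> (forall g, sym4 H g -> O2 g) ->
  (forall g, sym_family (Cov2 H) g <-> O2 g) /\
  (forall g, sym_pair H g <-> O2 g).
Proof.
move=> HH rH xH symO; have cs1 := D3_circle R.
have q3 : Num.sqrt 3 ^+ 2 = 3 :> R by rewrite sqr_sqrtr.
have [p [u [t HE]]] := fixed_nform HH cs1 sqrt3_half_neq0 rH xH.
(* A third of a turn multiplies the weight 4 coordinate by -1/2, so invariance makes it vanish. *)
have uE : u = - p / 4.
  case: (rH) => _; rewrite HE nform_rotz -?HE // HE => /nform_inj[_ + _ _ _].
  have -> : (- 2^-1) ^+ 4 - 6 * (- 2^-1) ^+ 2 * (Num.sqrt 3 / 2) ^+ 2 +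
      (Num.sqrt 3 / 2) ^+ 4 = - 2^-1 :> R by field: q3.
  by move=> e; lra.
rewrite HE uE in HH rH xH symO *.
have [a [b [ab d2H]]] := tri_form_d2 HH symO.
exact: (Cov2_iso_of_d2 HH cs1 sqrt3_half_neq0 rH xH ab d2H).
Qed.

Lemma Cov2_pair_of_tetra_tri_iso H : inH4 H -> tetra_tri_iso H ->
  in_class (sym_family (Cov2 H)) (@O2 R) /\ in_class (sym_pair H) (@O2 R).
Proof.
move=> HH HC.
suff [h hS [CO PO]] : exists2 h, SO3 h &
   (forall g, sym_family (Cov2 (act4 h H)) g <-> O2 g) /\
   (forall g, sym_pair (act4 h H) g <-> O2 g).
  split; first by apply/(in_class_natural _ (@sym_Cov2_natural R) HH); exists h.
  by apply/(in_class_natural _ (@sym_pair_natural R) HH); exists h.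
case: HC => /(in_class_natural _ (@sym4_natural R) HH)[h hS hK]; exists h => //.
- apply: quad_Cov2_iso; [exact: act4_inH4| | |].
  + by apply/hK; apply: generated_sub; left.
  + by apply/hK; apply: generated_sub; right.
  + by move=> g /hK; apply: D4_sub_O2.
- apply: tri_Cov2_iso; [exact: act4_inH4| | |].
  + by apply/hK; apply: generated_sub; left.
  + by apply/hK; apply: generated_sub; right.
  + by move=> g /hK; apply: D3_sub_O2.
- apply: quad_Cov2_iso; [exact: act4_inH4| | |].
  + by apply/hK; apply: O2_rotz; ring.
  + by apply/hK; apply: O2_rotx_pi.
  + by move=> g /hK.
Qed.

End SymmetryClasses.

Theorem theorem9p5 (R : realType) (H : tensor4 R) :
  inH4 H ->
  (in_class (sym_family (Cov2 H)) (@O2 R) <->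
     [\/ in_class (sym4 H) (@D4 R), in_class (sym4 H) (@D3 R) | in_class (sym4 H) (@O2 R)])
  /\
  ([\/ in_class (sym4 H) (@D4 R), in_class (sym4 H) (@D3 R) | in_class (sym4 H) (@O2 R)] <->
     in_class (fun g => sym2 (d2 H) g /\ sym2 (c3 H) g) (@O2 R)).
Proof.
move=> HH; split; split.
- move=> /(in_class_natural _ (@sym_Cov2_natural R) HH)[h hS hO].
  apply: (tetra_tri_iso_act HH hS).
  by apply: tetra_tri_iso_of_Cov2 => //; apply: act4_inH4.
- by move=> /(Cov2_pair_of_tetra_tri_iso HH)[].
- by move=> /(Cov2_pair_of_tetra_tri_iso HH)[].
- move=> /(in_class_natural _ (@sym_pair_natural R) HH)[h hS hO].
  apply: (tetra_tri_iso_act HH hS).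
  by apply: tetra_tri_iso_of_pair => //; apply: act4_inH4.
Qed.
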